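(* For every $\alpha>0$ there exists an $(\alpha,\phi)$-standard permuton, for an appropriate function $\phi$.
   Context: A permuton is a probability measure $\mu$ on $[0,1]^2$ with uniform marginals: $\mu([0,1]\times A)=\mu(A\times[0,1])=\lambda_1(A)$ for all measurable $A\subseteq[0,1]$, where $\lambda_1$ is Lebesgue measure. The symbol $\sim$ means that the ratio of the two sides tends to $1$. BL-smooth: $\mu$ is BL-smooth if there exists $0<\epsilon\le1/2$ such that $\mu$ admits a density $f$ on $[0,\epsilon]^2$, and there exist $\alpha_->0$ and a measurable function $\phi_-:[0,\infty)^2\to[0,\infty)$, bounded on every compact and strictly positive almost everywhere, such that $f(tx,ty)\sim t^{\alpha_--1}\phi_-(x,y)$ when $t\to0$. TR-smooth, with parameters $(\alpha_+,\phi_+)$: the image of $\mu$ under $(x,y)\mapsto(1-x,1-y)$ is BL-smooth with parameters $(\alpha_+,\phi_+)$. $\mu$ is $(\alpha,\phi)$-smooth if it is both BL-smooth and TR-smooth, with $f(tx,ty)+f(1-tx,1-ty)\sim t^{\alpha-1}\phi(x,y)$ when $t\to0$; equivalently, $\alpha=\min\{\alpha_-,\alpha_+\}$ and $\phi=\phi_-\mathbf{1}_{\alpha_-\le\alpha_+}+\phi_+\mathbf{1}_{\alpha_+\le\alpha_-}$. $\mu$ is corner-balanced if for every $0<\epsilon\le1/2$ there is $0<\rho<1$ with $\mu([0,\epsilon]\times[\rho,1])>0$ and $\mu([1-\epsilon,1]\times[0,\rho])>0$. $\mu$ is $(\alpha,\phi)$-standard if it is $(\alpha,\phi)$-smooth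 and corner-balanced.
   Formalization: In BL- and TR-smoothness, φ₋ and φ₊ are required to be bounded only on compacts of [0,∞)² not containing (0,0); for α<1 boundedness near the origin is impossible since φ(sz)=s^{α−1}φ(z), and for α≥1 the two conditions agree. *)

(* Defs.v *)
From HB Require Import structures.
From mathcomp Require Import all_boot all_order all_algebra.
From mathcomp Require Import all_classical all_reals all_analysis.
From mathcomp Require Import ring lra.
Set Implicit Arguments.
Unset Strict Implicit.
Unset Printing Implicit Defensive.
Import Order.TTheory GRing.Theory Num.Theory.
Import numFieldNormedType.Exports.
Local Open Scope classical_set_scope.
Local Open Scope ring_scope.

Notation plane R := (measurableTypeR R * measurableTypeR R)%type.

Notation lebesgue2 R := (@lebesgue_measure R \x @lebesgue_measure R)%E.

(* Taking A = [0, 1] shows that a permuton gives full mass to the unit square. *)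
Definition permuton (R : realType) (mu : probability (plane R) R) : Prop :=
  forall A : set (measurableTypeR R), measurable A -> A `<=` `[0, 1] ->
    mu (`[0, 1] `*` A) = lebesgue_measure A /\
    mu (A `*` `[0, 1]) = lebesgue_measure A.

Definition quadrant (R : realType) : set (plane R) := `[0, +oo[ `*` `[0, +oo[.

Definition has_density_on (R : realType) (mu : set (plane R) -> \bar R)
    (f : plane R -> R) (D : set (plane R)) : Prop :=
  [/\ measurable_fun D f,
      forall z, D z -> 0 <= f z
    & forall A : set (plane R), measurable A -> A `<=` D ->
        mu A = (\int[lebesgue2 R]_(z in A) (f z)%:E)%E].

(* [u ~_(0^'+) v] says that u / v tends to 1 whenever v does not vanish near 0
   (asymp_ratio below); where phi z = 0 it says that g (t z) = 0 for all small
   t > 0. *)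
Definition corner_asymp (R : realType) (g : plane R -> R) (a : R)
    (phi : plane R -> R) : Prop :=
  forall z : plane R, quadrant z ->
    (fun t : R => g (t * z.1, t * z.2) : R) ~_(0^'+)
    (fun t : R => t `^ (a - 1) * phi z : R).

Definition bounded_on_compacts (R : realType) (D : set (plane R))
    (phi : plane R -> R) : Prop :=
  forall K : set (plane R), compact K -> K `<=` D ->
    [bounded (phi z : R) | z in K].

Lemma asympP (R : realType) (u v : R -> R) :
  u ~_(0^'+) v <->
  forall e : R, 0 < e -> \forall t \near 0^'+, `|u t - v t| <= e * `|v t|.
Proof. exact: eqaddoP. Qed.

Lemma asymp_ratio (R : realType) (u v : R -> R) :
  (\forall t \near 0^'+, v t != 0) ->
  u ~_(0^'+) v <-> u t / v t @[t --> 0^'+] --> (1 : R).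
Proof.
move=> v0; have E t (e : R) : v t != 0 ->
    (`|1 - u t / v t| <= e) = (`|u t - v t| <= e * `|v t|).
  move=> vt; rewrite -ler_pdivrMr ?normr_gt0// -normfV -normrM mulrBl divff//.
  by rewrite distrC.
rewrite asympP; split=> [uv|/cvgrPdist_le uv e e0].
  apply/cvgrPdist_le => e e0; near=> t.
  by rewrite E; [near: t; exact: uv | near: t].
near=> t; rewrite -E; first by near: t; exact: uv.
by near: t.
Unshelve. all: by end_near. Qed.

Lemma corner_asymp_homog (R : realType) (g : plane R -> R) (a : R)
    (phi : plane R -> R) (z : plane R) (s : R) :
  corner_asymp g a phi -> quadrant z -> 0 < s ->
  phi (s * z.1, s * z.2) = s `^ (a - 1) * phi z.
Proof.
move=> ga qz s0; set c1 := LHS; set c2 := RHS.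
have qsz : quadrant ((s * z.1, s * z.2) : plane R).
  move: qz => [/=]; rewrite !in_itv/= !andbT => z1 z2.
  by split; rewrite /= in_itv/= andbT mulr_ge0// ltW.
have /asympP h1 := ga _ qsz.
have /asympP h2 := ga _ qz.
have h2' (e : R) : 0 < e -> \forall t \near 0^'+,
    `|g (t * (s * z.1), t * (s * z.2)) - t `^ (a - 1) * c2| <=
    e * `|t `^ (a - 1) * c2|.
  move=> e0; have [d /= d0 hd] := h2 e e0.
  exists (d / s) => /=; first exact: divr_gt0.
  move=> t /=; rewrite sub0r normrN ltr_pdivlMr// => td t0.
  have ts0 : 0 < t * s by exact: mulr_gt0.
  have := hd (t * s); rewrite /= sub0r normrN normrM (gtr0_norm s0).
  move=> /(_ td ts0); rewrite /c2 powRM ?(ltW t0) ?(ltW s0)//. rewrite -!mulrA; exact.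
apply/eqP; rewrite -subr_eq0; apply/eqP/normr0_eq0/eqP.
rewrite eq_le normr_ge0 andbT; apply/ler_addgt0Pr => e e0; rewrite add0r.
set M := `|c1| + `|c2| + 1.
have M0 : 0 < M by rewrite /M; have := normr_ge0 c1; have := normr_ge0 c2; lra.
have eM : 0 < e / M by exact: divr_gt0.
near (0 : R)^'+ => t.
have t0 : 0 < t by near: t; exact: nbhs_right_gt.
have k1 : `|g (t * (s * z.1), t * (s * z.2)) - t `^ (a - 1) * c1| <=
    e / M * `|t `^ (a - 1) * c1| by near: t; exact: h1.
have k2 : `|g (t * (s * z.1), t * (s * z.2)) - t `^ (a - 1) * c2| <=
    e / M * `|t `^ (a - 1) * c2| by near: t; exact: h2'.
have p0 : 0 < t `^ (a - 1) by exact: powR_gt0.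
have : `|t `^ (a - 1) * c1 - t `^ (a - 1) * c2| <=
    e / M * (`|t `^ (a - 1) * c1| + `|t `^ (a - 1) * c2|).
  rewrite mulrDr; apply: le_trans (lerD k1 k2); rewrite [X in _ <= X + _]distrC.
  by apply: le_trans (ler_normD _ _); rewrite addrA subrK.
rewrite -mulrBr !normrM -mulrDr (gtr0_norm p0) mulrCA ler_pM2l// => /le_trans.
apply; rewrite -[leRHS](divfK (lt0r_neq0 M0)) ler_wpM2l ?(ltW eM)// -normrM /M lerDl.
Unshelve. all: by end_near. Qed.

Lemma bounded_all_lt1 (R : realType) (g : plane R -> R) (a : R)
    (phi : plane R -> R) :
  corner_asymp g a phi -> a < 1 ->
  bounded_on_compacts (@quadrant R) phi ->
  forall z, quadrant z -> phi z = 0.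
Proof.
move=> ga a1 bd z qz; have [] := qz; rewrite /= !in_itv/= !andbT => z1 z2.
pose K : set (plane R) := `[0, z.1] `*` `[0, z.2].
have Kc : compact K by apply: compact_setX; exact: segment_compact.
have Kq : K `<=` @quadrant R.
  by move=> w [/=]; rewrite !in_itv/= => /andP[+ _] /andP[+ _];
    rewrite /quadrant/= !in_itv/= !andbT.
have [N [_ hN]] := bd _ Kc Kq.
have {}hN : forall w, K w -> `|phi w| <= `|N| + 1.
  by move=> w Kw; apply: (hN (`|N| + 1)) => //;
    rewrite (le_lt_trans (ler_norm _))// ltrDl.
apply: contrapT => /eqP pz; have p0 : 0 < `|phi z| by rewrite normr_gt0.
set B := `|N| + 1 in hN.
have B0 : 0 < B by rewrite /B; have := normr_ge0 N; lra.
pose r := Num.max 1 ((B + 1) / `|phi z|).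
have r1 : 1 <= r by rewrite le_max lexx.
have r0 : 0 < r by exact: lt_le_trans r1.
pose s := r `^ ((a - 1)^-1).
have s0 : 0 < s by exact: powR_gt0.
have s1 : s <= 1.
  by rewrite -[leRHS](powRr0 r) ler_powR// invr_le0 subr_le0 ltW.
have := hN (s * z.1, s * z.2).
have Ks : K (s * z.1, s * z.2).
  by split; rewrite /= in_itv/= mulr_ge0 ?(ltW s0)//= ler_piMl.
move=> /(_ Ks); rewrite (corner_asymp_homog ga)// -powRrM mulVf ?powRr1 ?(ltW r0)//.
  rewrite normrM (gtr0_norm r0) leNgt => /negP; apply.
  rewrite -ltr_pdivrMr// lt_max; apply/orP; right.
  by rewrite ltr_pM2r ?invr_gt0//; lra.
by rewrite subr_eq0 lt_eqF.
Qed.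

Lemma bounded_all_ge1 (R : realType) (g : plane R -> R) (a : R)
    (phi : plane R -> R) :
  corner_asymp g a phi -> 1 <= a ->
  bounded_on_compacts (@quadrant R `\ (0, 0)) phi ->
  bounded_on_compacts (@quadrant R) phi.
Proof.
move=> ga a1 bd K Kc Kq.
pose S : set (plane R) := (`[0, 1] `*` `[1, 1]) `|` (`[1, 1] `*` `[0, 1]).
have Sc : compact S.
  by apply: compactU; apply: compact_setX; exact: segment_compact.
have Sq : S `<=` @quadrant R.
  by move=> w [] [/=]; rewrite !in_itv/= => /andP[? _] /andP[? _];
    rewrite /quadrant/= !in_itv/= !andbT; split => //; apply: le_trans ler01 _.
have S0 : ~ S (0, 0).
  by move=> [] [/=]; rewrite !in_itv/= => /andP[? _] /andP[? _]; lra.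
have Sq0 : S `<=` @quadrant R `\ (0, 0).
  by move=> w Sw; split; [exact: Sq | move=> /= w0; apply: S0; rewrite -w0].
have [N [_ hN]] := bd _ Sc Sq0.
have {}hN : forall w, S w -> `|phi w| <= `|N| + 1.
  by move=> w Sw; apply: (hN (`|N| + 1)) => //;
    rewrite (le_lt_trans (ler_norm _))// ltrDl.
have [B [_ hB]] := compact_bounded Kc.
have {}hB : forall w, K w -> `|w : (R * R)%type| <= `|B| + 1.
  by move=> w Kw; apply: (hB (`|B| + 1)) => //;
    rewrite (le_lt_trans (ler_norm _))// ltrDl.
pose C := `|phi (0, 0)| + (`|B| + 1) `^ (a - 1) * (`|N| + 1).
exists C; split; first exact: num_real.
move=> M CM w Kw /=; apply: le_trans (ltW CM).
have [] := Kq _ Kw; rewrite /= !in_itv/= !andbT => w1 w2.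
pose s := Num.max (w.1 : R) (w.2 : R).
have sB : s <= `|B| + 1.
  apply: le_trans (hB _ Kw); rewrite prod_normE /= /s.
  by rewrite ge_max !le_max !ler_norm /= orbT.
have N1 : 0 <= `|N| + 1 by rewrite addr_ge0.
have s0 : 0 <= s by rewrite le_max w1.
have [s00|sN0] := eqVneq s 0.
  have -> : w = (0, 0).
    have : (w.1 : R) <= s by rewrite le_max lexx.
    have : (w.2 : R) <= s by rewrite le_max lexx orbT.
    rewrite s00 => w20 w10; rewrite [w]surjective_pairing.
    by congr pair; apply/eqP; rewrite eq_le ?w20 ?w10 ?w1 ?w2.
  by rewrite /C lerDl mulr_ge0// powR_ge0.
have sp : 0 < s by rewrite lt_def sN0.
have i1 (x : R) : 0 <= x -> x <= s -> 0 <= s^-1 * x <= 1.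
  by move=> x0 xs; rewrite mulr_ge0 ?invr_ge0//= mulrC ler_pdivrMr// mul1r.
have i2 (x : R) : x = s -> 1 <= s^-1 * x <= 1.
  by move=> ->; rewrite mulVf// lexx.
have qz : S (s^-1 * w.1, s^-1 * w.2).
  have [le|le] := leP (w.1 : R) (w.2 : R).
    left; split; rewrite /= in_itv/=; first by apply: i1 => //; rewrite le_max lexx.
    by apply: i2; rewrite /s; apply/esym/max_idPr.
  right; split; rewrite /= in_itv/=.
    by apply: i2; rewrite /s; apply/esym/max_idPl/ltW.
  by apply: i1 => //; rewrite le_max lexx orbT.
have -> : w = (s * (s^-1 * w.1, s^-1 * w.2).1, s * (s^-1 * w.1, s^-1 * w.2).2).
  by rewrite /= !mulrA divff// !mul1r; case: (w).
rewrite (corner_asymp_homog ga (Sq _ qz) sp) normrM ger0_norm ?powR_ge0//.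
apply: (@le_trans _ _ ((`|B| + 1) `^ (a - 1) * (`|N| + 1))); last by rewrite /C lerDr.
apply: ler_pM => //; [exact: powR_ge0| |exact: hN].
by apply: ge0_ler_powR; rewrite ?nnegrE ?subr_ge0// addr_ge0.
Qed.

(* Boundedness of phi is required on the compacts of [0, +oo[^2 \ {(0, 0)}:
   corner_asymp forces phi (s z) = s ^ (a - 1) phi z, so that phi is unbounded
   near the origin for a < 1 (bounded_all_lt1), while for 1 <= a it is then
   bounded on every compact of [0, +oo[^2 (bounded_all_ge1). *)
Definition BL_smooth (R : realType) (mu : set (plane R) -> \bar R)
    (f : plane R -> R) (a : R) (phi : plane R -> R) : Prop :=
  exists eps : R,
    [/\ 0 < eps <= 2^-1,
        has_density_on mu f (`[0, eps] `*` `[0, eps]),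
        0 < a,
        [/\ measurable_fun (@quadrant R) phi,
            forall z, quadrant z -> 0 <= phi z,
            bounded_on_compacts (@quadrant R `\ (0, 0)) phi
          & {ae lebesgue2 R, forall z, quadrant z -> 0 < phi z}]
      & corner_asymp f a phi].

Definition flip (R : realType) (z : plane R) : plane R := (1 - z.1, 1 - z.2).

(* f is the density of mu near (1, 1), hence f \o flip that of the image
   measure near (0, 0). *)
Definition TR_smooth (R : realType) (mu : set (plane R) -> \bar R)
    (f : plane R -> R) (a : R) (phi : plane R -> R) : Prop :=
  BL_smooth (pushforward mu (@flip R)) (f \o @flip R) a phi.

Definition smooth (R : realType) (mu : set (plane R) -> \bar R)
    (a : R) (phi : plane R -> R) : Prop :=
  exists (f : plane R -> R) (am ap : R) (phim phip : plane R -> R),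
    [/\ BL_smooth mu f am phim, TR_smooth mu f ap phip
      & corner_asymp (fun z => f z + f (flip z)) a phi].

Definition corner_balanced (R : realType) (mu : set (plane R) -> \bar R) : Prop :=
  forall eps : R, 0 < eps <= 2^-1 ->
    exists rho : R,
      [/\ 0 < rho < 1,
          (0 < mu (`[0%R, eps] `*` `[rho, 1%R]))%E
        & (0 < mu (`[(1 - eps)%R, 1%R] `*` `[0%R, rho]))%E].

Definition standard (R : realType) (mu : set (plane R) -> \bar R)
    (a : R) (phi : plane R -> R) : Prop :=
  smooth mu a phi /\ corner_balanced mu.

(* Main.v *)
Require Import Defs.
From mathcomp Require Import all_boot all_order all_algebra.
From HB Require Import structures.
From mathcomp Require Import all_classical all_reals all_analysis.
From mathcomp Require Import measurable_realfun ring lra.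
Import Order.TTheory GRing.Theory Num.Theory.
Import numFieldNormedType.Exports.
Local Open Scope classical_set_scope.
Local Open Scope ring_scope.

(* Put the density h(x, y) = (alpha/2) (x + y)^(alpha - 1), homogeneous of degree
   alpha - 1, on [0, 1/2]^2. Both of its marginals have density
   K(x) = ((x + 1/2)^alpha - x^alpha) / 2 <= 1/2, so what the first marginal lacks,
   (1 - K(x)) dx on [0, 1/2], may be carried by the antidiagonal y = 1 - x. Adding
   to the resulting measure sigma its image under (x, y) |-> (1 - x, 1 - y) also
   repairs the second marginal, because [0, 1/2] and its reflection tile [0, 1].
   The square blocks give the two smooth corners, and the antidiagonal, charged
   everywhere, gives corner balance. *)

(** * Measures given by densities and by images *)

Lemma density_measure d (T : measurableType d) (R : realType)
    (mu : {measure set T -> \bar R}) (f : T -> \bar R) :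
  measurable_fun setT f -> (forall x, 0 <= f x)%E ->
  exists nu : {measure set T -> \bar R},
    forall A, nu A = (\int[mu]_(x in A) f x)%E.
Proof.
move=> mf f0; pose nu (A : set T) : \bar R := (\int[mu]_(x in A) f x)%E.
have nu0 : nu set0 = 0%E by exact: integral_set0.
have nu_ge0 A : (0 <= nu A)%E by exact: integral_ge0.
have nu_sigma : semi_sigma_additive nu by exact: semi_sigma_additive_nng_induced.
pose nuM : {measure set T -> \bar R} :=
  HB.pack nu (isMeasure.Build _ _ _ nu nu0 nu_ge0 nu_sigma).
by exists nuM.
Qed.

Lemma pushforward_measure d1 d2 (T1 : measurableType d1) (T2 : measurableType d2)
    (R : realType) (mu : {measure set T1 -> \bar R}) (f : T1 -> T2) :
  measurable_fun setT f ->
  exists nu : {measure set T2 -> \bar R}, forall A, nu A = mu (f @^-1` A).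
Proof.
move=> mf; pose nu := (pushforward mu f : {measure set T2 -> \bar R}).
by exists (nu mf).
Qed.

(** * Lebesgue measure under the reflection of [0, 1] *)

Definition reflect1 {R : realType} (x : measurableTypeR R) : measurableTypeR R :=
  1 - x.

Lemma reflect1K {R : realType} : involutive (@reflect1 R).
Proof. by move=> x; rewrite /reflect1; lra. Qed.

Lemma measurable_reflect1 {R : realType} : measurable_fun setT (@reflect1 R).
Proof. exact: measurable_funB. Qed.

Lemma measurable_preimage_reflect1 {R : realType} (A : set (measurableTypeR R)) :
  measurable A -> measurable (@reflect1 R @^-1` A).
Proof. by move=> mA; rewrite -[X in measurable X]setTI; exact: measurable_reflect1. Qed.

(** Uniqueness of Lebesgue measure reduces the claim to intervals ]a, b]; their preimages [1 - b, 1
    - a[ are open at the other end but have the same length. *)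
Lemma lebesgue_measure_reflect1 {R : realType} (A : set (measurableTypeR R)) :
  measurable A -> lebesgue_measure (@reflect1 R @^-1` A) = lebesgue_measure A.
Proof.
move=> mA.
have [nu nuE] := pushforward_measure _ _ _ _ _ (@lebesgue_measure R) _ measurable_reflect1.
rewrite -nuE; apply/esym.
apply: lebesgue_measure_unique mA => //= _ [[a b]] _ <-.
rewrite nuE /=.
rewrite (_ : _ @^-1` _ = `[1 - b, 1 - a[%classic); last first.
  apply/seteqP; split => x /=; rewrite !in_itv/= /reflect1 => /andP[h1 h2];
    by apply/andP; split; lra.
rewrite !lebesgue_measure_itv/= !lte_fin ltrD2l ltrN2.
by case: ifPn => // _; rewrite -!EFinB; congr EFin; lra.
Qed.

(* The two halves [0, 1/2] and [1/2, 1] overlap in a null set. *)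
Lemma lebesgue_measure_fold {R : realType} (A : set (measurableTypeR R)) :
  measurable A -> A `<=` `[0, 1] ->
  (lebesgue_measure (A `&` `[0%R, 2^-1%R]) +
   lebesgue_measure (@reflect1 R @^-1` A `&` `[0%R, 2^-1%R]) =
   lebesgue_measure A)%E.
Proof.
move=> mA A01.
have mI (i : interval R) : measurable (A `&` [set` i]) by exact: measurableI.
have -> : @reflect1 R @^-1` A `&` `[0, 2^-1] =
    @reflect1 R @^-1` (A `&` `[2^-1, 1]).
  rewrite preimage_setI; congr (_ `&` _).
  by apply/seteqP; split => x /=; rewrite !in_itv/= /reflect1 => /andP[h1 h2];
    apply/andP; split; lra.
rewrite lebesgue_measure_reflect1//.
have -> : A `&` `[2^-1, 1] = A `&` `]2^-1, 1] `|` A `&` [set` `[2^-1, 2^-1]].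
  rewrite -setIUr; congr (_ `&` _).
  apply/seteqP; split => [x|x []] /=; rewrite !in_itv/= => /andP[h1 h2].
    have [h|h] := leP x 2^-1; first by right; rewrite h1.
    by left; rewrite h2.
  - by apply/andP; split; lra.
  - by apply/andP; split; lra.
rewrite measureU0//; last first.
  apply/eqP; rewrite eq_le measure_ge0 andbT.
  rewrite -(lebesgue_measure_set1 (2^-1 : R)) -set_itv1.
  by apply: le_measure; rewrite ?inE//; exact: subIsetr.
have {3}-> : A = A `&` `[0, 2^-1] `|` A `&` `]2^-1, 1].
  rewrite -setIUr; apply/esym/setIidPl => x /A01/=; rewrite !in_itv/= => /andP[-> ->].
  by rewrite andbT /=; case: (leP x 2^-1) => h; [left|right].
rewrite [in RHS]measureU//.
rewrite setIACA setIid; apply/seteqP; split => // x [_ []] /=.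
by rewrite !in_itv/= => /andP[_ h1] /andP[h2 _]; lra.
Qed.

(** * Tonelli's theorem on rectangles *)

(** Tonelli on the whole product applies to [f] extended by 0 off [A] times [B]; the extension then
    splits into one restriction per variable. *)
Lemma integral_setX d1 d2 (T1 : measurableType d1) (T2 : measurableType d2)
    (R : realType) (m1 : {sigma_finite_measure set T1 -> \bar R})
    (m2 : {sigma_finite_measure set T2 -> \bar R}) (f : T1 * T2 -> \bar R)
    (A : set T1) (B : set T2) :
  measurable A -> measurable B ->
  measurable_fun setT f -> (forall z, 0 <= f z)%E ->
  (\int[m1 \x m2]_(z in A `*` B) f z =
   \int[m1]_(x in A) \int[m2]_(y in B) f (x, y))%E /\
  (\int[m1 \x m2]_(z in A `*` B) f z =
   \int[m2]_(y in B) \int[m1]_(x in A) f (x, y))%E.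
Proof.
move=> mA mB mf f0; rewrite integral_mkcond.
have mfAB : measurable_fun setT (f \_ (A `*` B)).
  by apply: (measurable_restrictT _ (measurableX mA mB)).1; exact: measurable_funTS.
have fAB0 z : (0 <= (f \_ (A `*` B)) z)%E by rewrite patchE; case: ifPn.
have patchX x y : (f \_ (A `*` B)) (x, y) =
    if x \in A then (if y \in B then f (x, y) else 0%E) else 0%E.
  rewrite patchE; have [xA|xA] := boolP (x \in A); have [yB|yB] := boolP (y \in B).
  - by rewrite ifT//; rewrite inE; split => /=; rewrite -inE.
  - rewrite ifF//; apply/negbTE; rewrite notin_setE => -[_ /=].
    by rewrite -[B y]/(B y) => By; move: yB; rewrite notin_setE.
  - rewrite ifF//; apply/negbTE; rewrite notin_setE => -[/= Ax _].
    by move: xA; rewrite notin_setE.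
  - rewrite ifF//; apply/negbTE; rewrite notin_setE => -[/= Ax _].
    by move: xA; rewrite notin_setE.
have E1 : (\int[m1 \x m2]_z (f \_ (A `*` B)) z =
   \int[m1]_(x in A) \int[m2]_(y in B) f (x, y))%E.
  rewrite fubini_tonelli1// [RHS]integral_mkcond; apply: eq_integral => x _.
  rewrite /fubini_F patchE; under eq_integral do rewrite patchX.
  case: ifPn => xA; last exact: integral0.
  by rewrite [RHS]integral_mkcond; apply: eq_integral => y _; rewrite patchE.
split => //; rewrite fubini_tonelli2// [RHS]integral_mkcond.
apply: eq_integral => y _; rewrite /fubini_G patchE.
under eq_integral do rewrite patchX.
case: ifPn => yB; last by under eq_integral do rewrite if_same; exact: integral0.
by rewrite [RHS]integral_mkcond; apply: eq_integral => x _; rewrite patchE.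
Qed.

(** * Half of the permuton: a square block plus an antidiagonal *)

(** The four clauses serve, in order, the first marginal and the total mass (hence the general [U]),
    the second marginal after symmetrisation, the densities at the two corners, and corner
    balance. *)
Lemma half_permuton (R : realType) (h : plane R -> R) (K : measurableTypeR R -> R) :
  measurable_fun setT h -> (forall z, 0 <= h z) ->
  (forall x y, h (x, y) = h (y, x)) ->
  measurable_fun setT K ->
  (forall x, x \in `[0, 2^-1] -> 0 <= K x <= 2^-1) ->
  {ae @lebesgue_measure R, forall x, x \in `[0, 2^-1] ->
     (\int[lebesgue_measure]_(y in `[0%R, 2^-1%R]) (h (x, y))%:E = (K x)%:E)%E} ->
  exists sigma : {measure set (plane R) -> \bar R},
    [/\ forall A U : set (measurableTypeR R), measurable A -> measurable U -> `[0, 1] `<=` U ->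
          sigma (A `*` U) = lebesgue_measure (A `&` `[0%R, 2^-1%R]),
        forall A : set (measurableTypeR R), measurable A ->
          (sigma (`[0%R, 1%R] `*` A) + sigma (`[0%R, 1%R] `*` (reflect1 @^-1` A)) =
           lebesgue_measure (A `&` `[0%R, 2^-1%R]) +
           lebesgue_measure (reflect1 @^-1` A `&` `[0%R, 2^-1%R]))%E,
        forall A : set (plane R), measurable A -> A `<=` `[0, 4^-1] `*` `[0, 4^-1] ->
          sigma A = (\int[lebesgue2 R]_(z in A) (h z)%:E)%E /\
          sigma (@flip R @^-1` A) = 0%E
      & forall e : R, 0 < e <= 2^-1 ->
          (0 < sigma (`[0%R, e] `*` `[2^-1%R, 1%R]))%E].
Proof.
move=> mh h0 hC mK K01 hK.
pose I : set (measurableTypeR R) := [set` `[(0 : R), 2^-1]].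
have mI : measurable I by exact: measurable_itv.
have mhE : measurable_fun setT (EFin \o h) by exact/measurable_EFinP.
have mII : measurable (I `*` I : set (plane R)) by exact: measurableX.
pose hI : plane R -> \bar R := (EFin \o h) \_ (I `*` I).
have mhI : measurable_fun setT hI.
  by apply: (measurable_restrictT _ mII).1; exact: measurable_funTS.
have hI0 z : (0 <= hI z)%E by rewrite /hI patchE; case: ifPn => //; rewrite lee_fin h0.
have [nu nuE] := density_measure _ _ _ (lebesgue2 R) hI mhI hI0.
have {}nuE A : nu A = (\int[lebesgue2 R]_(z in A `&` (I `*` I)) (h z)%:E)%E.
  by rewrite nuE integral_mkcondr.
(* [L] is the density that the first marginal of the square block lacks; [r] below lifts it to the
   antidiagonal. *)
pose L : measurableTypeR R -> \bar R := (fun x => (1 - K x)%:E) \_ I.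
have m1K : measurable_fun setT (fun x => (1 - K x)%:E).
  by apply/measurable_EFinP; exact: measurable_funB.
have mL : measurable_fun setT L.
  by apply: (measurable_restrictT _ mI).1; exact: measurable_funTS.
have K1 x : I x -> 2^-1 <= 1 - K x by move=> /K01/andP[? ?]; lra.
have K1' x : I x -> (0 <= (1 - K x)%:E)%E.
  by move=> /K1 ?; rewrite lee_fin; lra.
have L0 x : (0 <= L x)%E.
  by rewrite /L patchE; case: ifPn => //; rewrite inE => /K1'.
have [kap kapE] := density_measure _ _ _ (@lebesgue_measure R) L mL L0.
have {}kapE A : kap A = (\int[lebesgue_measure]_(x in A `&` I) (1 - K x)%:E)%E.
  by rewrite kapE integral_mkcondr.
pose r (x : measurableTypeR R) : plane R := (x, reflect1 x).
have mr : measurable_fun setT r.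
  by apply: measurable_fun_pair => //; exact: measurable_reflect1.
have [tau tauE] := pushforward_measure _ _ _ _ _ kap _ mr.
have nuX A B : measurable A -> measurable B ->
    nu (A `*` B) = (\int[lebesgue_measure]_(x in A `&` I)
                      \int[lebesgue_measure]_(y in B `&` I) (h (x, y))%:E)%E /\
    nu (A `*` B) = (\int[lebesgue_measure]_(y in B `&` I)
                      \int[lebesgue_measure]_(x in A `&` I) (h (x, y))%:E)%E.
  move=> mA mB; rewrite nuE.
  have -> : (A `*` B) `&` (I `*` I) = (A `&` I) `*` (B `&` I).
    by apply/seteqP; split => [z [[? ?] []]|z [[? ?] []]].
  apply: (integral_setX _ _ _ _ _ lebesgue_measure lebesgue_measure (EFin \o h)) => //;
    exact: measurableI.
have EK A : measurable A ->
    (\int[lebesgue_measure]_(x in A `&` I) \int[lebesgue_measure]_(y in I) (h (x, y))%:E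
     = \int[lebesgue_measure]_(x in A `&` I) (K x)%:E)%E.
  move=> mA; apply: ae_eq_integral.
  - exact: measurableI.
  - apply: measurable_funTS.
    (* The inner integral is measurable in x as a section integral of [h] extended by 0 off the
       strip [setT] times [I]. *)
    rewrite (_ : (fun x => _) = fubini_F lebesgue_measure
      ((EFin \o h) \_ (setT `*` I) : plane R -> \bar R)); last first.
      apply/funext => x; rewrite /fubini_F [LHS]integral_mkcond.
      apply: eq_integral => y _; rewrite !patchE; congr (if _ then _ else _).
      by rewrite in_setX in_setT.
    apply: measurable_fun_fubini_tonelli_F.
      apply: (measurable_restrictT _ (measurableX measurableT mI)).1.
      exact: measurable_funTS.
    by move=> z; rewrite patchE; case: ifPn => //; rewrite lee_fin h0.
  - by apply: measurable_funTS; exact/measurable_EFinP.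
  - apply: (@filterS _ _ (ae_filter_ringOfSetsType lebesgue_measure)) hK => x hx [_ Ix]; exact: hx.
have MKL A : measurable A ->
    (\int[lebesgue_measure]_(x in A `&` I) (K x)%:E +
     \int[lebesgue_measure]_(x in A `&` I) (1 - K x)%:E =
     lebesgue_measure (A `&` I))%E.
  move=> mA; have mAI : measurable (A `&` I) by exact: measurableI.
  rewrite -ge0_integralD//.
  - rewrite -[RHS]mul1e -integral_cst//; apply: eq_integral => x _ /=.
    by rewrite -EFinD; congr EFin; lra.
  - by move=> x [_ /K01/andP[? _]]; rewrite lee_fin.
  - by apply: measurable_funTS; exact/measurable_EFinP.
  - by move=> x [_ Ix]; exact: K1'.
  - exact: measurable_funTS.
pose sigma : {measure set (plane R) -> \bar R} := measure_add nu tau.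
have sigmaE A : sigma A = (nu A + kap (r @^-1` A))%E by rewrite -tauE; exact: measure_addE.
have m01 : measurable ([set` `[(0 : R), 1]] : set (measurableTypeR R)) by exact: measurable_itv.
have I01 : I `<=` `[0, 1].
  by move=> x; rewrite /I/= !in_itv/= => /andP[-> ?]; lra.
have I01' x : I x -> `[0, 1]%classic (reflect1 x).
  by rewrite /I/= !in_itv/= /reflect1 => /andP[? ?]; apply/andP; split; lra.
(* By symmetry of [h], [K] also serves for the second marginal of the block; the antidiagonal places
   the weight 1 - K(x) at height 1 - x. *)
have sigmaY A : measurable A -> sigma (`[0, 1] `*` A) =
    (\int[lebesgue_measure]_(x in A `&` I) (K x)%:E +
     \int[lebesgue_measure]_(x in reflect1 @^-1` A `&` I) (1 - K x)%:E)%E.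
  move=> mA; rewrite sigmaE (nuX _ _ m01 mA).2 (setIidr I01) -EK//; congr (_ + _)%E.
    apply: eq_integral => y _; apply: eq_integral => x _; by rewrite hC.
  rewrite kapE; congr (integral _ _ _).
  by apply/seteqP; split => x [] //=; [move=> [] //|move=> Ax Ix; split => //; split => //; exact: I01].
exists sigma; split.
- move=> A U mA mU U01; rewrite sigmaE (nuX _ _ mA mU).1 -MKL//.
  rewrite (setIidr (subset_trans I01 U01)) EK// kapE; congr (_ + integral _ _ _)%E.
  apply/seteqP; split => x [] /=; first by move=> [].
  by move=> Ax Ix; split => //; split => //; exact/U01/I01'.
- move=> A mA; have mA' := measurable_preimage_reflect1 _ mA.
  rewrite !sigmaY// -!MKL//.
  (* Reflecting twice returns [A], so each summand supplies the 1 - K that completes the [K] of the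
     other. *)
  rewrite (_ : reflect1 @^-1` (reflect1 @^-1` A) = A); last first.
    by apply/seteqP; split => x /=; rewrite reflect1K.
  rewrite addeACA [RHS]addeACA; congr (_ + _)%E; exact: addeC.
(* The small square lies in the block, and its flip in [3/4, 1]^2 misses the block. The antidiagonal
   misses both, since its coordinates sum to 1. *)
- move=> A mA A4; split.
    rewrite sigmaE nuE setIidl; last first.
      move=> z /A4[]; rewrite /I/= !in_itv/= => /andP[? ?] /andP[? ?].
      by split; apply/andP; split; lra.
    rewrite (_ : r @^-1` A = set0) ?measure0 ?adde0//.
    apply/seteqP; split => // x /A4[]; rewrite /= !in_itv/= /reflect1.
    by move=> /andP[? ?] /andP[? ?]; lra.
  rewrite sigmaE nuE (_ : _ `&` _ = set0); last first.
    apply/seteqP; split => // z [/A4[]]; rewrite /I/= !in_itv/=.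
    by move=> /andP[? ?] /andP[? ?] [] /= /andP[? ?]; lra.
  rewrite integral_set0 (_ : r @^-1` _ = set0) ?measure0 ?adde0//.
  apply/seteqP; split => // x /A4[]; rewrite /= !in_itv/= /reflect1.
  by move=> /andP[? ?] /andP[? ?]; lra.
- move=> e /andP[e0 e2]; rewrite sigmaE.
  apply: (@lt_le_trans _ _ (kap (r @^-1` (`[0, e] `*` `[2^-1, 1])))); last first.
    by rewrite leeDr.
  rewrite kapE (_ : _ `&` I = `[0, e]%classic); last first.
    apply/seteqP; split => x /=; rewrite /I !in_itv/= /reflect1; first by move=> [[]].
    move=> /andP[x0 xe]; split; last by rewrite /= in_itv/= x0; lra.
    by split; apply/andP; split; lra.
  (* Since K <= 1/2, the antidiagonal has density at least 1/2 and contributes at least e/2. *)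
  apply: (@lt_le_trans _ _ (\int[lebesgue_measure]_(x in `[0%R, e]) (2^-1%R)%:E)%E).
    rewrite integral_cst//= lebesgue_measure_itv/= lte_fin e0 -EFinB -EFinM lte_fin.
    by rewrite subr0 mulr_gt0// invr_gt0.
  apply: ge0_le_integral => //.
  - exact: measurable_funTS.
  - move=> x xe; rewrite lee_fin; apply: K1; move: xe.
    by rewrite /I/= !in_itv/= => /andP[-> /le_trans ->].
Qed.

(** * Symmetrisation under the flip *)

Lemma measurable_flip (R : realType) : measurable_fun setT (@flip R).
Proof.
apply: measurable_fun_pair.
- exact: (measurableT_comp measurable_reflect1 measurable_fst).
- exact: (measurableT_comp measurable_reflect1 measurable_snd).
Qed.

Lemma preimage_flip_setX (R : realType) (A B : set (measurableTypeR R)) :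
  @flip R @^-1` (A `*` B) = (reflect1 @^-1` A) `*` (reflect1 @^-1` B).
Proof. by []. Qed.

Lemma preimage_reflect1_itv (R : realType) (a b : R) :
  @reflect1 R @^-1` [set` `[a, b]] = [set` `[1 - b, 1 - a]].
Proof.
by apply/seteqP; split => x /=; rewrite !in_itv/= /reflect1 => /andP[? ?];
  apply/andP; split; lra.
Qed.

(** Adding to [sigma] its flipped image turns each marginal into the fold of Lebesgue measure at
    1/2. Near either corner only one summand has mass, so both corners show the same density [h]. *)
Lemma corner_permuton (R : realType) (h : plane R -> R) (K : measurableTypeR R -> R) :
  measurable_fun setT h -> (forall z, 0 <= h z) ->
  (forall x y, h (x, y) = h (y, x)) ->
  measurable_fun setT K ->
  (forall x, x \in `[0, 2^-1] -> 0 <= K x <= 2^-1) ->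
  {ae @lebesgue_measure R, forall x, x \in `[0, 2^-1] ->
     (\int[lebesgue_measure]_(y in `[0%R, 2^-1%R]) (h (x, y))%:E = (K x)%:E)%E} ->
  exists mu : probability (plane R) R,
    [/\ permuton mu, corner_balanced mu
      & forall A : set (plane R), measurable A -> A `<=` `[0, 4^-1] `*` `[0, 4^-1] ->
          mu A = (\int[lebesgue2 R]_(z in A) (h z)%:E)%E /\
          mu (@flip R @^-1` A) = (\int[lebesgue2 R]_(z in A) (h z)%:E)%E].
Proof.
move=> mh h0 hC mK K01 hK.
have [sigma [sX sY s4 s0]] := half_permuton _ _ _ mh h0 hC mK K01 hK.
have [tau tauE] := pushforward_measure _ _ _ _ _ sigma _ (@measurable_flip R).
pose nu : {measure set (plane R) -> \bar R} := measure_add sigma tau.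
have nuE A : nu A = (sigma A + sigma (@flip R @^-1` A))%E.
  by rewrite -tauE; exact: measure_addE.
have m01 : measurable ([set` `[(0 : R), 1]] : set (measurableTypeR R)).
  exact: measurable_itv.
have r01 : @reflect1 R @^-1` `[0, 1] = `[0, 1]%classic.
  by rewrite preimage_reflect1_itv subrr subr0.
(* Each summand has mass 1/2, the length of [0, 1/2]. *)
have nu1 : nu setT = 1%E.
  rewrite nuE preimage_setT -setXTT sX// setTI lebesgue_measure_itv/= lte_fin.
  by rewrite invr_gt0 ltr0n -EFinB -EFinD; congr EFin; lra.
pose mu : probability (plane R) R :=
  HB.pack (Measure.sort nu) (Measure_isProbability.Build _ _ _ nu nu1).
have muE A : mu A = (sigma A + sigma (@flip R @^-1` A))%E by exact: nuE.
exists mu; split.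
- move=> A mA A01; have mA' := measurable_preimage_reflect1 _ mA.
  by rewrite !muE !preimage_flip_setX r01 sY// !sX// lebesgue_measure_fold.
(* One rho works for every e: [sigma] charges the upper left rectangle, and its flipped image the
   lower right one. *)
- move=> e e0; exists 2^-1; rewrite !muE !preimage_flip_setX !preimage_reflect1_itv.
  split; first by apply/andP; split; lra.
  + by apply: lt_le_trans (s0 _ e0) _; rewrite leeDl.
  + apply: lt_le_trans (s0 _ e0) _; rewrite subrr subr0 subKr.
    by rewrite (_ : 1 - 2^-1 = 2^-1 :> R) ?leeDr//; lra.
- move=> A mA A4; have [sA sA'] := s4 _ mA A4; rewrite !muE sA sA' adde0; split => //.
  rewrite (_ : @flip R @^-1` (@flip R @^-1` A) = A) ?add0e//.
  by apply/seteqP; split => -[x y] /=; rewrite /flip/= !subKr.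
Qed.

(** * The homogeneous density and its marginal *)

Definition corner_density {R : realType} (a : R) (z : plane R) : R :=
  a / 2 * (z.1 + z.2) `^ (a - 1).

Definition corner_marginal {R : realType} (a : R) (x : measurableTypeR R) : R :=
  ((x + 2^-1) `^ a - x `^ a) / 2.

Lemma measurable_corner_density {R : realType} (a : R) :
  measurable_fun setT (@corner_density R a).
Proof.
apply: measurable_funM; first exact: measurable_cst.
have ms : measurable_fun setT (fun z : plane R => z.1 + z.2 : R).
  by apply: measurable_funD; [exact: measurable_fst|exact: measurable_snd].
exact: (measurableT_comp (@measurable_powR R (a - 1)) ms).
Qed.

Lemma corner_density_ge0 {R : realType} (a : R) (z : plane R) :
  0 < a -> 0 <= corner_density a z.
Proof. by move=> a0; rewrite mulr_ge0 ?powR_ge0// divr_ge0// ltW. Qed.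

(* At z = (0, 0) this relies on 0 `^ (a - 1) = 0 for a != 1, also when a < 1. *)
Lemma corner_densityZ {R : realType} (a t : R) (z : plane R) :
  0 < t -> quadrant z ->
  corner_density a (t * z.1, t * z.2) = t `^ (a - 1) * corner_density a z.
Proof.
move=> t0 []; rewrite /= !in_itv/= !andbT => z1 z2.
by rewrite /corner_density/= -mulrDr powRM ?(ltW t0) ?addr_ge0// mulrCA.
Qed.

Lemma measurable_corner_marginal {R : realType} (a : R) :
  measurable_fun setT (@corner_marginal R a).
Proof.
apply: measurable_funM; last exact: measurable_cst.
apply: measurable_funB; last exact: measurable_powR.
have ms : measurable_fun setT (fun x : measurableTypeR R => x + 2^-1 : R).
  exact: measurable_funD.
exact: (measurableT_comp (@measurable_powR R a) ms).
Qed.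

(** On [0, 1/2] both powers have base at most 1, so their difference lies in [0, 1]; the factor 1/2
    leaves room for the antidiagonal. *)
Lemma corner_marginal_bounds {R : realType} (a : R) (x : R) :
  0 < a -> x \in `[0, 2^-1] -> 0 <= corner_marginal a x <= 2^-1.
Proof.
move=> a0; rewrite in_itv/= => /andP[x0 x2]; rewrite /corner_marginal.
have h1 : x `^ a <= (x + 2^-1) `^ a.
  by apply: ge0_ler_powR; rewrite ?nnegrE ?(ltW a0)//; lra.
have h2 : (x + 2^-1) `^ a <= 1.
  (* The bound 1 is rewritten as 1 to the power a, so that monotonicity of the power applies. *)
  rewrite -[leRHS]/((fun=> 1) a) -powR1.
  by apply: ge0_ler_powR; rewrite ?nnegrE ?(ltW a0)//; lra.
have h3 := powR_ge0 x a.
by apply/andP; split; lra.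
Qed.

(** The fundamental theorem of calculus with primitive F(y) = (x + y)^a / 2. As x > 0, the base
    stays positive up to y = 0, so the integrand is continuous on the closed interval even when a <
    1. *)
Lemma integral_corner_density {R : realType} (a x : R) : 0 < a -> 0 < x ->
  (\int[lebesgue_measure]_(y in `[0%R, 2^-1%R]) (corner_density a (x, y))%:E =
   (corner_marginal a x)%:E)%E.
Proof.
move=> a0 x0; pose F y : R := (x + y) `^ a / 2.
have shift (p y : R) : 0 <= y -> is_derive y 1 (fun y : R => (x + y) `^ p) (p * (x + y) `^ (p - 1)).
  move=> y0; have xy : 0 < x + y by lra.
  have d1 := is_derive1_powR p xy.
  have d2 : is_derive y 1 (fun y : R => x + y) (1 : R).
    by have := is_deriveD (is_derive_cst x y 1) (is_derive_id y 1); rewrite add0r.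
  by have := is_derive1_comp d1 d2; rewrite mulr1.
have dF (y : R) : 0 <= y -> is_derive y 1 F (corner_density a (x, y)).
  move=> y0; rewrite /F /corner_density/=.
  have := shift a y y0 => dy.
  rewrite (_ : a / 2 * _ = 2^-1 *: (a * (x + y) `^ (a - 1))); last first.
    by rewrite /GRing.scale/=; ring.
  rewrite (_ : (fun y => _) = 2^-1 \*: (fun y => (x + y) `^ a)).
    exact: is_deriveZ.
  by apply/funext => z /=; rewrite /GRing.scale/= mulrC.
have cF (y : R) : 0 <= y -> {for y, continuous F}.
  by move=> /dF [dy _]; apply/differentiable_continuous/derivable1_diffP.
rewrite (@continuous_FTC2 _ _ F) //.
- rewrite -EFinB; congr EFin; rewrite /F /corner_marginal addr0; lra.
- apply: derivable_within_continuous => y; rewrite in_itv/= => /andP[y0 _].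
  have dy := shift (a - 1) y y0.
  apply: derivableM => //; exact: ex_derive.
- split.
  + by move=> y; rewrite in_itv/= => /andP[/ltW /dF[]].
  + by apply: cvg_at_right_filter; apply: cF.
  + by apply: cvg_at_left_filter; apply: cF; rewrite invr_ge0.
- move=> y; rewrite in_itv/= => /andP[/ltW /dF dy _].
  by rewrite derive1E; exact: derive_val.
Qed.

(** On the quadrant z.1 + z.2 vanishes only at the origin, so the density is continuous on [K] and
    its image of [K] is compact. *)
Lemma bounded_corner_density {R : realType} (a : R) :
  bounded_on_compacts (@quadrant R `\ (0, 0)) (corner_density a).
Proof.
move=> K Kc Kq.
have : compact (corner_density a @` K).
  apply: continuous_compact => //; apply: continuous_in_subspaceT => z.
  rewrite inE => /Kq[[]]; rewrite /= !in_itv/= !andbT => z1 z2 z0.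
  have s0 : 0 < z.1 + z.2.
    rewrite lt_neqAle addr_ge0// andbT eq_sym paddr_eq0//.
    by apply: contra_notN z0 => /andP[/eqP h1 /eqP h2]; rewrite [z]surjective_pairing h1 h2.
  have cs : (fun z : plane R => z.1 + z.2 : R) w @[w --> z] --> (z.1 + z.2 : R).
    by apply: cvgD; [exact: cvg_fst|exact: cvg_snd].
  have cp : {for (z.1 + z.2 : R), continuous (fun x : R => x `^ (a - 1))}.
    apply/differentiable_continuous/derivable1_diffP.
    by apply: derivable_powR; rewrite in_itv/= s0.
  by apply: cvgM; [exact: cvg_cst|exact: (cvg_comp _ _ cs cp)].
move=> /compact_bounded [N [Nr hN]]; exists N; split => // M NM z Kz /=.
by apply: hN => //; exists z.
Qed.

Lemma ae_corner_density_gt0 {R : realType} (a : R) : 0 < a ->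
  {ae lebesgue2 R, forall z, quadrant z -> 0 < corner_density a z}.
Proof.
move=> a0; exists ([set 0] `*` [set 0]); split.
- exact: measurableX.
- have e0 : lebesgue_measure ([set 0] : set (measurableTypeR R)) = 0%E.
    exact: lebesgue_measure_set1.
  by rewrite product_measure1E//= [X in (X * _)%E]e0 mul0e.
- move=> z /= /not_implyP[[]]; rewrite /= !in_itv/= !andbT => z1 z2 h.
  suff : z.1 + z.2 == 0 by rewrite paddr_eq0// => /andP[/eqP -> /eqP ->].
  apply: contra_notT h => s0; rewrite /corner_density mulr_gt0 ?divr_gt0//.
  by rewrite powR_gt0// lt_neqAle eq_sym s0 addr_ge0.
Qed.

(** * Smoothness at the two corners *)

(** [smooth] asks for a single f at both corners, so the two formulas are glued along the
    antidiagonal; only the values near the corners have to represent the measure. *)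
Definition two_corner_density {R : realType} (a : R) (z : plane R) : R :=
  if z.1 + z.2 <= 1 then corner_density a z else corner_density a (flip z).

Lemma two_corner_density_BL {R : realType} (a : R) (z : plane R) :
  z.1 + z.2 <= 1 -> two_corner_density a z = corner_density a z.
Proof. by rewrite /two_corner_density => ->. Qed.

Lemma two_corner_density_TR {R : realType} (a : R) (z : plane R) :
  z.1 + z.2 < 1 -> two_corner_density a (flip z) = corner_density a z.
Proof.
move=> z1; rewrite /two_corner_density /= ifF; last by apply/negbTE; rewrite -ltNge; lra.
by congr corner_density; case: z z1 => x y _; rewrite /flip/= !subKr.
Qed.

Lemma near0_scaled_sum_lt1 {R : realType} (z : plane R) :
  \forall t \near (0 : R)^'+, t * z.1 + t * z.2 < 1.
Proof.
have M0 : 0 < `|z.1| + `|z.2| + 1 :> R.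
  by have := normr_ge0 (z.1 : R); have := normr_ge0 (z.2 : R); lra.
near=> t.
have t0 : 0 < t by near: t; exact: nbhs_right_gt.
have : t * (`|z.1| + `|z.2| + 1) < 1.
  rewrite -ltr_pdivlMr// mul1r; near: t; apply: nbhs_right_lt; by rewrite invr_gt0.
apply: le_lt_trans; rewrite -mulrDr ler_pM2l//.
by have := ler_norm (z.1 : R); have := ler_norm (z.2 : R); lra.
Unshelve. all: by end_near. Qed.

(** By homogeneity the asymptotic relation is an exact equality once t is small enough that t z lies
    below the antidiagonal, so points with phi z = 0 need no separate case. *)
Lemma corner_asymp_homogeneous {R : realType} (g : plane R -> R) (a : R)
    (phi : plane R -> R) :
  (forall z t, quadrant z -> 0 < t -> phi (t * z.1, t * z.2) = t `^ (a - 1) * phi z) ->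
  (forall z, z.1 + z.2 < 1 -> g z = phi z) ->
  corner_asymp g a phi.
Proof.
move=> phiZ gphi z qz; apply/asympP => e e0.
near=> t.
have t0 : 0 < t by near: t; exact: nbhs_right_gt.
rewrite gphi; last by near: t; exact: near0_scaled_sum_lt1.
by rewrite phiZ// subrr normr0 mulr_ge0// ltW.
Unshelve. all: by end_near. Qed.

(** Stated for an arbitrary set function, so as to apply both to the permuton and to its image under
    [flip]. *)
Lemma BL_smooth_corner_density {R : realType} (nu : set (plane R) -> \bar R)
    (f : plane R -> R) (a : R) : 0 < a ->
  (forall z, z.1 + z.2 < 1 -> f z = corner_density a z) ->
  (forall A : set (plane R), measurable A -> A `<=` `[0, 4^-1] `*` `[0, 4^-1] ->
     nu A = (\int[lebesgue2 R]_(z in A) (corner_density a z)%:E)%E) ->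
  BL_smooth nu f a (corner_density a).
Proof.
move=> a0 fE nuE; exists 4^-1.
have DE z : (`[0, 4^-1] `*` `[0, 4^-1]) z -> f z = corner_density a z.
  by move=> [/=]; rewrite !in_itv/= => /andP[_ ?] /andP[_ ?]; apply: fE; lra.
split => //.
- by apply/andP; split; lra.
- split.
  + apply: (eq_measurable_fun (corner_density a)).
      by move=> z; rewrite inE => /DE.
    apply: measurable_funTS; exact: measurable_corner_density.
  + by move=> z /DE ->; exact: corner_density_ge0.
  + move=> A mA AD; rewrite nuE//; apply: eq_integral => z; rewrite inE => /AD/DE -> //.
- split.
  + apply: measurable_funTS; exact: measurable_corner_density.
  + by move=> z _; exact: corner_density_ge0.
  + exact: bounded_corner_density.
  + exact: ae_corner_density_gt0.
- apply: corner_asymp_homogeneous => // z t qz t0; exact: corner_densityZ.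
Qed.

Theorem mainTheorem3 (R : realType) (alpha : R) (halpha : 0 < alpha) :
  exists (phi : plane R -> R) (mu : probability (plane R) R),
    permuton mu /\ standard mu alpha phi.
Proof.
have [||||||mu [pmu cmu muE]] :=
    corner_permuton R (corner_density alpha) (corner_marginal alpha).
- exact: measurable_corner_density.
- by move=> z; exact: corner_density_ge0.
- by move=> x y; rewrite /corner_density/= addrC.
- exact: measurable_corner_marginal.
- by move=> x; exact: corner_marginal_bounds.
(* The marginal formula is available for x > 0, and the remaining point 0 is null. *)
- exists [set 0]; split; [exact: measurable_set1|exact: lebesgue_measure_set1|].
  move=> x /= /not_implyP[x01]; apply: contra_notP => /eqP x0.
  apply: integral_corner_density => //.
  by move: x01; rewrite in_itv/= lt_neqAle eq_sym x0 => /andP[].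
(* Both corners have exponent alpha and the same profile, so their sum gives the factor 2. *)
exists (fun z => 2 * corner_density alpha z), mu; split => //; split => //.
exists (two_corner_density alpha), alpha, alpha, (corner_density alpha), (corner_density alpha).
split.
- apply: BL_smooth_corner_density => //.
  + by move=> z z1; apply: two_corner_density_BL; exact: ltW.
  + by move=> A mA A4; exact: (muE A mA A4).1.
- apply: BL_smooth_corner_density => //.
  + by move=> z z1; exact: two_corner_density_TR.
  + by move=> A mA A4; exact: (muE A mA A4).2.
- apply: corner_asymp_homogeneous => z.
  + by move=> t qz t0; rewrite corner_densityZ// mulrCA.
  + by move=> z1; rewrite two_corner_density_TR// two_corner_density_BL ?ltW// mulr_natl mulr2n.
Qed.
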